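(* Suppose $G\subset\mathbf{R}^n$ is a discrete subgroup and $g\in G$. Then a full loop $\tau:\mathbf{S}^1\to\mathbf{S}^{n-1}$ forms the tantrix of a $g$-homotopic skew loop in $\mathbf{R}^n/G$ if and only if all three of the following hold: (1) $\tau$ is embedded; (2) $\tau$ avoids its antipodal image, i.e. $\tau(\mathbf{S}^1)\cap(-\tau(\mathbf{S}^1))=\emptyset$; (3) $g$ lies in the interior of the convex cone over $\tau$, i.e. $g\in\mathrm{int}\,\mathrm{Cc}(\tau)$.
   Context: $G$ is a discrete additive subgroup of $\mathbf{R}^n$, with covering projection $\pi:\mathbf{R}^n\to\mathbf{R}^n/G$. A loop in $\mathbf{R}^n/G$ is a $C^1$ immersion of the circle; equivalently, a $C^1$ immersed arc $\sigma:[a,b]\to\mathbf{R}^n/G$ ($a<b$) with $\sigma(a)=\sigma(b)$ and $\dot\sigma(a)=\dot\sigma(b)$. All tangent spaces of $\mathbf{R}^n/G$ are identified with $\mathbf{R}^n$ by translation, so $\dot\sigma(t)\in\mathbf{R}^n$. The tantrix of $\sigma$ is the normalized velocity curve $\tau=\dot\sigma/|\dot\sigma|$, a map from the domain of $\sigma$ to the unit sphere $\mathbf{S}^{n-1}$. A loop $\sigma$ in $\mathbf{R}^n/G$ is skew if for distinct parameters $t_1\ne t_2$ in the circle, the tangent lines spanned by $\dot\sigma(t_1)$ and $\dot\sigma(t_2)$ never coincide under this identification. For $g\in G$, a loop in $\mathbf{R}^n/G$ is $g$-homotopic if it has the form $\pi\circ\alpha$ for an arc $\alpha:[a,b]\to\mathbf{R}^n$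 with $\alpha(b)-\alpha(a)=g$. A loop $\tau$ in $\mathbf{S}^{n-1}$ is a continuous map $\mathbf{S}^1\to\mathbf{S}^{n-1}$ (also viewed as a continuous arc on a compact interval with equal endpoint values); it is embedded if it is injective on the circle $\mathbf{S}^1$, and full if its image spans $\mathbf{R}^n$ linearly. A cone in $\mathbf{R}^n$ is a subset invariant under all positive dilations; for $A\subset\mathbf{R}^n$, $\mathrm{Cc}(A)$ denotes the smallest convex cone containing $A$ (the convex cone over $A$), and $\mathrm{Cc}(\tau)$ means the convex cone over the image of $\tau$. *)

(* Defs.v *)
From HB Require Import structures.
From mathcomp Require Import all_boot all_order all_algebra.
From mathcomp Require Import all_classical all_reals all_analysis.

Set Implicit Arguments.
Unset Strict Implicit.
Unset Printing Implicit Defensive.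

Import Order.TTheory GRing.Theory Num.Theory.
Import numFieldNormedType.Exports.

Local Open Scope classical_set_scope.
Local Open Scope ring_scope.
Local Open Scope quotient_scope.

(* The library norm [`|v|] on ['rV[R]_n] is the sup norm, which induces the
   right topology but the wrong unit sphere. *)
Definition euclidean_norm (R : realType) n (v : 'rV[R]_n) : R :=
  Num.sqrt (\sum_(i < n) v ord0 i ^+ 2).

Definition unit_sphere (R : realType) n : set 'rV[R]_n :=
  [set v | euclidean_norm v = 1].

Definition discrete_subgroup (R : realType) n (G : zmodClosed 'rV[R]_n) : Prop :=
  isolated [set` G] = [set` G].

(* [Quotient.quot G] (displayed as [{ideal_quot G}]) is R^n/G as a quotient group.
   A curve defined on [a, b] is a total function on [R] of which only the values
   on [a, b] are used, and a circle is such an interval with its endpoints glued,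
   so that [a, b[ lists the parameters of the circle once. *)
Section QuotientCurves.
Context {R : realType} {n : nat} (G : zmodClosed 'rV[R]_n).
Implicit Types (a b t : R) (v : 'rV[R]_n) (sigma : R -> Quotient.quot G).

(* The smooth structure and the tangent spaces of R^n/G come from R^n through
   the covering projection: [sigma] has velocity [v] at [t] when some lift of
   [sigma] to R^n near [t] has derivative [v] at [t] (one-sided at a and b).
   For discrete G, the velocity does not depend on the lift. *)
Definition has_velocity a b sigma t v : Prop :=
  exists2 beta : R -> 'rV[R]_n,
    \forall s \near within `[a, b] (nbhs t), sigma s = \pi_(Quotient.quot G) (beta s) &
    (s - t)^-1 *: (beta s - beta t) @[s --> within `[a, b] t^'] --> v.

Definition velocity a b sigma t : 'rV[R]_n :=
  xget 0 [set v | has_velocity a b sigma t v].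

Definition C1_immersed_arc a b sigma : Prop :=
  [/\ forall t, t \in `[a, b] -> has_velocity a b sigma t (velocity a b sigma t),
      {within `[a, b], continuous (velocity a b sigma)}
    & forall t, t \in `[a, b] -> velocity a b sigma t != 0].

Definition quotient_loop a b sigma : Prop :=
  [/\ C1_immersed_arc a b sigma,
      sigma a = sigma b
    & velocity a b sigma a = velocity a b sigma b].

Definition tantrix a b sigma t : 'rV[R]_n :=
  (euclidean_norm (velocity a b sigma t))^-1 *: velocity a b sigma t.

Definition skew_loop a b sigma : Prop :=
  forall t1 t2, t1 \in `[a, b[ -> t2 \in `[a, b[ -> t1 != t2 ->
    (<[velocity a b sigma t1]> != <[velocity a b sigma t2]>)%VS.

Definition homotopic_to (g : 'rV[R]_n) a b sigma : Prop :=
  exists alpha : R -> 'rV[R]_n,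
    [/\ {within `[a, b], continuous alpha},
        forall t, t \in `[a, b] -> sigma t = \pi_(Quotient.quot G) (alpha t)
      & alpha b - alpha a = g].

End QuotientCurves.

Section SphericalLoops.
Context {R : realType} {n : nat}.
Implicit Types (a b t : R) (tau : R -> 'rV[R]_n) (A : set 'rV[R]_n).

Definition spherical_loop a b tau : Prop :=
  [/\ {within `[a, b], continuous tau},
      forall t, t \in `[a, b] -> unit_sphere (tau t)
    & tau a = tau b].

Definition embedded a b tau : Prop := {in `[a, b[ &, injective tau}.

Definition linear_span A : set 'rV[R]_n :=
  \bigcap_(U in [set U : {vspace 'rV[R]_n} | forall x, A x -> x \in U]) [set` U].

Definition full a b tau : Prop := linear_span (tau @` `[a, b]) = setT.

Definition is_cone A : Prop :=
  forall (c : R) x, 0 < c -> A x -> A (c *: x).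

(* Not assumed to contain 0. *)
Definition convex_cone A : Prop := is_cone A /\ convex_set A.

Definition Cc A : set 'rV[R]_n := smallest convex_cone A.

End SphericalLoops.

(* Main.v *)
(* If [f] is a linear form with [f >= 0] on the cone over [tau] and [f g <= 0],
   then [f] is monotone along a lift of [sigma], hence constant, so it vanishes
   on [tau]; fullness excludes this, which puts [g] in the interior of the cone.
   Conversely, the displacements [\int rho tau], for [rho] a positive periodic
   density, form a convex cone. A linear form separating [g] from this cone is
   nonnegative on [tau], which contradicts [g] being interior. So
   [g = \int rho tau] for some [rho], and the loop is the projection of
   [t |-> \int_a^t rho tau]. *)
From HB Require Import structures.
Require Import Defs.
From mathcomp Require Import all_boot all_order all_algebra.
From mathcomp Require Import all_classical all_reals all_analysis.
From mathcomp Require Import ring lra.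
Import Order.TTheory GRing.Theory Num.Theory.
Import numFieldNormedType.Exports.
Local Open Scope classical_set_scope.
Local Open Scope ring_scope.

(** * Convex cones: supporting forms, separation and interior points *)

Section ConvexCones.
Context {R : realType} {n : nat}.
Implicit Types (x y : 'rV[R]_n) (A D : set 'rV[R]_n) (f : 'cV[R]_n).

(** Doubling a midpoint turns convexity into closure under sums. Conversely, weights 0 and 1 are
    treated apart, since only positive dilations are available. *)
Lemma convex_coneP D :
  convex_cone D <->
  (forall (c : R) x, 0 < c -> D x -> D (c *: x)) /\
  (forall x y, D x -> D y -> D (x + y)).
Proof.
split=> [[Dcone Dconv]|[Dcone Dadd]]; split=> // x y.
- move=> Dx Dy.
  have /set_mem : (2^-1 *: x + (1 - 2^-1) *: y) \in D.
    have h01 : 0 <= (2^-1 : R) <= 1 by apply/andP; split; lra.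
    have := Dconv x y (Itv01 (proj1 (andP h01)) (proj2 (andP h01))).
    by rewrite !inE; apply.
  have h2 : 0 < 2 :> R by lra.
  move=> /(Dcone 2 _ h2); rewrite scalerDr !scalerA.
  have -> : 2 * 2^-1 = 1 :> R by lra.
  have -> : 2 * (1 - 2^-1) = 1 :> R by lra.
  by rewrite !scale1r.
- move=> l /set_mem Dx /set_mem Dy; apply/mem_set.
  have [->|l0] := eqVneq l 0%:i01; first by rewrite conv0.
  have [->|l1] := eqVneq l 1%:i01; first by rewrite conv1.
  apply: Dadd; apply: Dcone => //.
    by rewrite lt_neqAle eq_sym l0 /=.
  by rewrite subr_gt0 lt_neqAle l1 /=.
Qed.

Lemma Cc_convex_cone A : convex_cone (Cc A).
Proof.
apply/convex_coneP; split=> [c x c0 Ax|x y Ax Ay] M [Mcone AM].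
  by apply: (proj1 Mcone) => //; apply: Ax.
by apply: (proj2 ((convex_coneP M).1 Mcone)); [apply: Ax|apply: Ay].
Qed.

End ConvexCones.

(* By induction on the dimension: when the first coordinate [s] takes both signs
   on [D], a form [f] nonnegative on the slice [s = 0] extends with the slope
   [c = sup {- f y / s | (s, y) in D, s > 0}]. *)
Lemma convex_cone_support (R : realType) (n : nat) (D : set 'rV[R]_n) :
  (0 < n)%N -> convex_cone D -> ~ D 0 ->
  exists2 f : 'cV[R]_n, f != 0 & forall x, D x -> 0 <= (x *m f) 0 0.
Proof.
elim: n D => // n IHn D _ /convex_coneP[DZ Dadd] D0.
(* Points split into a first coordinate [s] and a remainder [y]; dually, forms split into a slope
   [c] and a form [f] on the remainder. *)
pose pt (s : R) (y : 'rV[R]_n) : 'rV[R]_(1 + n) := row_mx s%:M y.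
have ptD s y s' y' : pt s y + pt s' y' = pt (s + s') (y + y').
  by rewrite /pt add_row_mx raddfD.
have ptZ c s y : c *: pt s y = pt (c * s) (c *: y).
  by rewrite /pt scale_row_mx scale_scalar_mx.
have ptE (x : 'rV[R]_(1 + n)) : exists s y, x = pt s y.
  exists (lsubmx x 0 0), (rsubmx x).
  by rewrite /pt -mx11_scalar hsubmxK.
pose fn (c : R) (f : 'cV[R]_n) : 'cV[R]_(1 + n) := col_mx c%:M f.
have fnE s y c f : (pt s y *m fn c f) 0 0 = s * c + (y *m f) 0 0.
  by rewrite /pt /fn mul_row_col -scalar_mxM mxE mxE eqxx mulr1n.
have fn0 c f : fn c f = 0 -> c = 0 /\ f = 0.
  rewrite /fn -[0]col_mx0 => /eq_col_mx[/matrixP/(_ 0 0)].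
  by rewrite !mxE eqxx mulr1n.
(* If the first coordinate has constant sign on [D], it is, up to sign, the required form. *)
have [Dpos|/existsNP[x1]] := pselect (forall s y, D (pt s y) -> 0 <= s).
  exists (fn 1 0); first by apply/eqP => /fn0[/eqP]; rewrite oner_eq0.
  by move=> x; have [s [y ->]] := ptE x => /Dpos; rewrite fnE mulmx0 mxE addr0 mulr1.
move=> /existsNP[y1 /not_implyP[Dxy1 /negP]]; rewrite -ltNge => x10.
have [Dneg|/existsNP[x2]] := pselect (forall s y, D (pt s y) -> s <= 0).
  exists (fn (-1) 0); first by apply/eqP => /fn0[/eqP]; rewrite oppr_eq0 oner_eq0.
  by move=> x; have [s [y ->]] := ptE x => /Dneg; rewrite fnE mulmx0 mxE addr0 mulrN1 oppr_ge0.
move=> /existsNP[y2 /not_implyP[Dxy2 /negP]]; rewrite -ltNge => x20.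
(* The positive weights [s'] and [- s] cancel the first coordinates, giving a point of the slice. *)
have D0cross s y s' y' : D (pt s y) -> D (pt s' y') -> s < 0 -> 0 < s' ->
    D (pt 0 (s' *: y - s *: y')).
  move=> Dsy Dsy' s0 s'0.
  have := Dadd _ _ (DZ _ _ s'0 Dsy) (DZ (- s) _ _ Dsy').
  rewrite oppr_gt0 => /(_ s0).
  by rewrite !ptZ ptD scaleNr; have -> : s' * s + - s * s' = 0 by ring.
pose E : set 'rV[R]_n := [set y | D (pt 0 y)].
have E0 : ~ E 0 by rewrite /E /pt /= raddf0 row_mx0.
(* In dimension zero the crossing point would be 0, which the slice does not contain. *)
have n0 : (0 < n)%N.
  rewrite lt0n; apply/eqP => n0; apply: E0.
  have := D0cross _ _ _ _ Dxy1 Dxy2 x10 x20.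
  set v := (X in pt 0 X); rewrite /E /= (_ : v = 0)//.
  by apply/matrixP => i [j jn]; exfalso; move: jn; rewrite n0.
have Econe : convex_cone E.
  apply/convex_coneP; split=> [c x c0 Ex|x y Ex Ey]; rewrite /E /=.
    by rewrite -(mulr0 c) -ptZ; exact: DZ.
  by rewrite -(addr0 0) -ptD; exact: Dadd.
have [f f0 fE] := IHn E n0 Econe E0.
pose lo := [set r | exists s y, [/\ D (pt s y), 0 < s & r = - (y *m f) 0 0 / s]].
(* Points with [s > 0] bound the slope from below, those with [s < 0] from above. The bounds are
   compatible because [f] is nonnegative at the crossing points. *)
have cross s y s' y' : D (pt s y) -> D (pt s' y') -> s < 0 -> 0 < s' ->
    - (y' *m f) 0 0 / s' <= - (y *m f) 0 0 / s.
  move=> Dsy Dsy' s0 s'0; have := fE _ (D0cross _ _ _ _ Dsy Dsy' s0 s'0).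
  rewrite mulmxBl -!scalemxAl !mxE => h.
  rewrite ler_pdivrMr// mulrAC ler_ndivlMr//.
  by lra.
have lo_ub s y : D (pt s y) -> s < 0 -> ubound lo (- (y *m f) 0 0 / s).
  by move=> Dsy s0 _ [s' [y' [Dsy' s'0 ->]]]; exact: cross.
have lo0 : lo (- (y2 *m f) 0 0 / x2) by exists x2, y2.
exists (fn (sup lo) f); first by apply/eqP => /fn0[_ /eqP]; apply/negP.
move=> x; have [s [y ->]] := ptE x => Dsy; rewrite fnE.
have [s0|s0|s0] := ltgtP s 0.
- have : sup lo <= - (y *m f) 0 0 / s.
    by apply: ge_sup; [exists (- (y2 *m f) 0 0 / x2)|exact: lo_ub].
  by rewrite ler_ndivlMr//; lra.
- have : - (y *m f) 0 0 / s <= sup lo.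
    apply: ub_le_sup; last by exists s, y.
    by exists (- (y1 *m f) 0 0 / x1); exact: lo_ub.
  by rewrite ler_pdivrMr//; lra.
- by move: Dsy; rewrite s0 mul0r add0r => /fE.
Qed.

(** A form nonnegative on [C] minus the open ray through [w] is nonnegative on [C] and nonpositive
    at [w]; separation from [C] thus reduces to support of this cone. *)
Lemma convex_cone_shift (R : realType) (n : nat) (C : set 'rV[R]_n) w :
  convex_cone C ->
  convex_cone [set y | exists x l, [/\ C x, 0 < l & y = x - l *: w]].
Proof.
move=> /convex_coneP[CZ Cadd]; apply/convex_coneP.
split=> [c _ c0 [x [l [Cx l0 ->]]]|_ _ [x [l [Cx l0 ->]]] [y [m [Cy m0 ->]]]].
  exists (c *: x), (c * l); split; [exact: CZ|exact: mulr_gt0|].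
  by rewrite scalerBr scalerA.
exists (x + y), (l + m); split; [exact: Cadd|exact: addr_gt0|].
by rewrite scalerDl opprD addrACA.
Qed.

(** Small [l] forces the first inequality, large [l] the second. *)
Lemma le_of_scaled (R : realType) (k m : R) :
  (forall l, 0 < l -> l * k <= m) -> 0 <= m /\ k <= 0.
Proof.
move=> km; split; rewrite leNgt; apply/negP => h.
  have d0 : 0 < 2 * (`|k| + 1) by rewrite mulr_gt0 ?ltr_wpDl.
  have := km (- m / (2 * (`|k| + 1))) (divr_gt0 _ d0).
  rewrite oppr_gt0 mulrAC ler_pdivrMr// => /(_ h).
  by have := ler_norm (- k); rewrite normrN; nra.
have := km ((`|m| + 1) / k) (divr_gt0 (ltr_wpDl (normr_ge0 _) ltr01) h).
by rewrite divfK ?gt_eqF//; have := ler_norm m; lra.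
Qed.

Lemma convex_cone_separation (R : realType) (n : nat) (C : set 'rV[R]_n) g :
  (0 < n)%N -> C !=set0 -> convex_cone C -> ~ C g ->
  exists f : 'cV[R]_n,
    [/\ f != 0, forall x, C x -> 0 <= (x *m f) 0 0 & (g *m f) 0 0 <= 0].
Proof.
move=> n0 [x0 Cx0] Ccone Cg; have [CZ _] := (convex_coneP C).1 Ccone.
pose D := [set y | exists x l, [/\ C x, 0 < l & y = x - l *: g]].
(* If 0 were in [D], then [g] would be a positive multiple of a point of [C]. *)
have Dcone : convex_cone D := convex_cone_shift _ _ _ g Ccone.
have D0 : ~ D 0.
  move=> [x [l [Cx l0 /esym/eqP]]]; rewrite subr_eq0 => /eqP xlg; apply: Cg.
  have -> : g = l^-1 *: x by rewrite xlg scalerA mulVf ?scale1r ?gt_eqF.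
  by apply: CZ; rewrite ?invr_gt0.
have [f f0 fD] := convex_cone_support _ _ D n0 Dcone D0.
have fC x l : C x -> 0 < l -> l * (g *m f) 0 0 <= (x *m f) 0 0.
  move=> Cx l0; have : D (x - l *: g) by exists x, l.
  by move=> /fD; rewrite mulmxBl -scalemxAl !mxE subr_ge0.
exists f; split=> // [x Cx|].
  by have [] := le_of_scaled _ _ _ (fC x ^~ Cx).
by have [] := le_of_scaled _ _ _ (fC x0 ^~ Cx0).
Qed.

(** Finitely many directions, plus and minus each basis vector, already give a box around [g] inside
    the cone. *)
Lemma convex_cone_interior (R : realType) (n : nat) (C : set 'rV[R]_n) g :
  convex_cone C -> (forall w, exists2 e, 0 < e & C (g + e *: w)) -> C° g.
Proof.
move=> /convex_coneP[CZ Cadd] Cg.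
have Cg0 : C g by have [e _] := Cg 0; rewrite scaler0 addr0.
have Cseg w e d : C (g + e *: w) -> 0 <= d < e -> C (g + d *: w).
  move=> Cw /andP[]; rewrite le_eqVlt => /predU1P[<- _|d0 de].
    by rewrite scale0r addr0.
  have e0 : 0 < e := lt_trans d0 de.
  have -> : g + d *: w = (1 - d / e) *: g + (d / e) *: (g + e *: w).
    by rewrite scalerDr scalerA addrA -scalerDl subrK scale1r divfK ?gt_eqF.
  apply: Cadd; apply: CZ => //; last exact: divr_gt0.
  by rewrite subr_gt0 ltr_pdivrMr ?mul1r.
(* A point [y] of the box is the average of [g] and [n] points, the [j]-th of which moves from [g]
   along the [j]-th axis only, by [m] times the displacement of [y]. *)
pose m : R := n.+1%:R.
have m0 : 0 < m by rewrite ltr0n.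
exists (fun _ j => [set r | C (g + (m * (r - g 0 j)) *: delta_mx 0 j)]).
  move=> i j; rewrite ord1.
  have [e1 e10 Ce1] := Cg (delta_mx 0 j).
  have [e2 e20 Ce2] := Cg (- delta_mx 0 j).
  apply/nbhs_ballP; exists (Num.min e1 e2 / m) => /=.
    by rewrite divr_gt0// lt_min e10.
  move=> r; rewrite /ball/= ltr_pdivlMr// distrC lt_min => /andP[r1 r2].
  have [r0|r0] := leP (g 0 j) r.
    apply: Cseg Ce1 _; apply/andP; split; first by rewrite mulr_ge0 ?subr_ge0// ltW.
    by move: r1; rewrite ger0_norm ?subr_ge0// mulrC.
  rewrite -[_ *: _]opprK -scaleNr -scalerN; apply: Cseg Ce2 _.
  rewrite -mulrN opprB; apply/andP; split; first by rewrite mulr_ge0// ?subr_ge0// ltW.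
  by move: r2; rewrite ltr0_norm ?subr_lt0// opprB mulrC.
move=> y /= Cy.
pose z j := g + (m * (y 0 j - g 0 j)) *: delta_mx 0 j.
have -> : y = m^-1 *: (g + \sum_(j < n) z j).
  rewrite big_split/= sumr_const card_ord.
  rewrite addrA -mulrS -[g *+ _]scaler_nat -/m.
  under eq_bigr do rewrite -scalerA.
  rewrite -scaler_sumr -scalerDr scalerA mulVf ?gt_eqF// scale1r.
  under eq_bigr do rewrite scalerBl.
  by rewrite sumrB -!row_sum_delta addrC subrK.
apply: CZ; first by rewrite invr_gt0.
(* The alternative 0 accounts for the empty sum, as the cone may not contain 0. *)
have [->|/(Cadd _ _ Cg0)//] : \sum_(j < n) z j = 0 \/ C (\sum_(j < n) z j).
  elim/big_ind : _ => [|x x' [->|Cx] [->|Cx']|j _]; rewrite ?addr0 ?add0r.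
  - by left.
  - by left.
  - by right.
  - by right.
  - by right; exact: Cadd.
  - by right; exact: Cy.
by rewrite addr0.
Qed.

(** If [g] is not interior, some direction [w] leaves [C] at once, so [g] lies outside [C] minus the
    open ray through [w] and can be separated from it. *)
Lemma convex_cone_interior_support (R : realType) (n : nat) (C : set 'rV[R]_n) g :
  (0 < n)%N -> C !=set0 -> convex_cone C -> ~ C° g ->
  exists f : 'cV[R]_n,
    [/\ f != 0, forall x, C x -> 0 <= (x *m f) 0 0 & (g *m f) 0 0 <= 0].
Proof.
move=> n0 [x0 Cx0] Ccone Cg.
have [w Cw] : exists w, forall e, 0 < e -> ~ C (g + e *: w).
  have /existsNP[w Cw] : ~ (forall w, exists2 e, 0 < e & C (g + e *: w)).
    by move=> /(convex_cone_interior _ _ _ _ Ccone).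
  by exists w => e e0 Ce; apply: Cw; exists e.
pose D := [set y | exists x l, [/\ C x, 0 < l & y = x - l *: w]].
have Dcone : convex_cone D := convex_cone_shift _ _ _ w Ccone.
have D0 : D !=set0 by exists (x0 - 1 *: w), x0, 1.
have Dg : ~ D g.
  by move=> [x [l [Cx l0 gE]]]; apply: (Cw l l0); rewrite gE subrK.
have [f [f0 fD fg]] := convex_cone_separation _ _ D g n0 D0 Dcone Dg.
exists f; split=> // x Cx.
have fx l : 0 < l -> l * (w *m f) 0 0 <= (x *m f) 0 0.
  move=> l0; have : D (x - l *: w) by exists x, l.
  by move=> /fD; rewrite mulmxBl -scalemxAl !mxE subr_ge0.
by have [] := le_of_scaled _ _ _ fx.
Qed.

(** * Derivatives along a closed interval, one-sided at its endpoints *)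

Section DerivativeWithin.
Context {R : realType} (a b : R).
Implicit Types (V W : normedModType R) (t : R).

Definition has_derivative_within V (F : R -> V) t (v : V) :=
  (s - t)^-1 *: (F s - F t) @[s --> within `[a, b] t^'] --> v.

(** Points of the interval accumulate at [t] from the right if [t < b], and from the left at [b].
    This makes limits, hence derivatives, unique. *)
Lemma within_dnbhs_proper t : a < b -> t \in `[a, b] ->
  ProperFilter (within `[a, b] t^').
Proof.
move=> ab; rewrite in_itv/= => /andP[ta tb]; apply: Build_ProperFilter_ex => P.
move=> /nbhs_ballP[e /= e0 eP].
have [tb'|bt] := ltP t b.
- have [s /andP[ts sm]] : exists s, t < s < Num.min b (t + e).
    exists ((t + Num.min b (t + e)) / 2).
    have : t < Num.min b (t + e) by rewrite lt_min tb' ltrDl.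
    by move=> ?; apply/andP; split; lra.
  move: sm; rewrite lt_min => /andP[sb se].
  exists s; apply: eP; rewrite /ball/= ?gt_eqF//.
    by rewrite distrC gtr0_norm; lra.
  by rewrite in_itv/=; apply/andP; split; lra.
- have [s /andP[ts sm]] : exists s, Num.max a (t - e) < s < t.
    exists ((t + Num.max a (t - e)) / 2).
    have : Num.max a (t - e) < t by rewrite gt_max; apply/andP; split; lra.
    by move=> ?; apply/andP; split; lra.
  move: ts; rewrite gt_max => /andP[sb se].
  exists s; apply: eP; rewrite /ball/= ?lt_eqF//.
    by rewrite gtr0_norm; lra.
  by rewrite in_itv/=; apply/andP; split; lra.
Qed.

Lemma has_derivative_within_unique V (F : R -> V) t v w : a < b -> t \in `[a, b] ->
  has_derivative_within V F t v -> has_derivative_within V F t w -> v = w.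
Proof.
move=> ab tab Fv Fw; have FF := within_dnbhs_proper _ ab tab.
exact: (cvg_unique _ Fv Fw).
Qed.

Lemma cvg_subr t : (s - t) @[s --> t] --> (0 : R).
Proof. by rewrite -(subrr t); exact: (@cvgB _ R _ (nbhs t) _ id (cst t) t t cvg_id (cvg_cst t)). Qed.

Lemma has_derivative_within_cvg V (F : R -> V) t v :
  has_derivative_within V F t v -> F s @[s --> within `[a, b] (nbhs t)] --> F t.
Proof.
move=> Fv.
have st0 : (s - t) @[s --> within `[a, b] t^'] --> (0 : R).
  apply: cvg_trans (cvg_subr t); apply: cvg_app.
  by apply: cvg_trans (@nbhs_dnbhs _ t); exact: cvg_within.
(* For [s != t] this expression is [F s]. *)
have : (F t + (s - t) *: ((s - t)^-1 *: (F s - F t)))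
    @[s --> within `[a, b] t^'] --> F t + 0 *: v.
  by apply: cvgD; [exact: cvg_cst|exact: cvgZ].
rewrite scale0r addr0 => Ft P Pt.
have FP : \forall s \near t, s != t -> s \in `[a, b] ->
  P (F t + (s - t) *: ((s - t)^-1 *: (F s - F t))) := Ft P Pt.
suff : \forall s \near t, s \in `[a, b] -> P (F s) by [].
apply: filterS FP => s; have [-> _ _|st] := eqVneq s t; first exact: nbhs_singleton.
by rewrite scalerA mulfV ?subr_eq0// scale1r addrC subrK; apply.
Qed.

Lemma has_derivative_within_continuous V (F : R -> V) (v : R -> V) :
  (forall t, t \in `[a, b] -> has_derivative_within V F t (v t)) ->
  {within `[a, b], continuous F}.
Proof.
by move=> Fv; apply/subspace_continuousP => t /Fv /has_derivative_within_cvg.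
Qed.

Lemma has_derivative_withinD V (F G : R -> V) t v w :
  has_derivative_within V F t v -> has_derivative_within V G t w ->
  has_derivative_within V (F + G) t (v + w).
Proof.
move=> Fv Gw; rewrite /has_derivative_within.
under eq_fun do rewrite !fctE opprD addrACA scalerDr.
exact: cvgD.
Qed.

Lemma has_derivative_withinZ V (F : R -> V) t v (c : R) :
  has_derivative_within V F t v -> has_derivative_within V (c \*: F) t (c *: v).
Proof.
move=> Fv; rewrite /has_derivative_within.
under eq_fun do rewrite /= -scalerBr scalerA mulrC -scalerA.
exact: cvgZl_tmp.
Qed.

Lemma has_derivative_within_comp_linear V W (F : R -> V) t v (f : {linear V -> W}) :
  continuous f -> has_derivative_within V F t v ->
  has_derivative_within W (f \o F) t (f v).
Proof.
move=> fc Fv; rewrite /has_derivative_within.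
under eq_fun do rewrite /= -linearB -linearZ.
by apply: continuous_cvg => //; exact: fc.
Qed.

Lemma dnbhs_shift t : (h + t) @[h --> 0^'] --> t^'.
Proof.
move=> P /= Pt; have : (h + t) @[h --> (0 : R)] --> t.
  rewrite -[X in _ --> X]add0r.
  exact: (@cvgD _ R _ (nbhs (0 : R)) _ id (cst t) 0 t cvg_id (cvg_cst t)).
move=> /(_ _ Pt) Pt0.
have {}Pt : \forall h \near (0 : R), h + t != t -> P (h + t) := Pt0.
suff : \forall h \near (0 : R), h != 0 -> P (h + t) by [].
by apply: filterS Pt => h + h0; apply; rewrite -subr_eq0 addrK.
Qed.

Lemma dnbhs_unshift t : (s - t) @[s --> t^'] --> (0 : R)^'.
Proof.
move=> P /= Pt.
have {}Pt : \forall h \near t, h - t != 0 -> P (h - t) := cvg_subr t _ Pt.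
suff : \forall h \near t, h != t -> P (h - t) by [].
by apply: filterS Pt => h + h0; apply; rewrite subr_eq0.
Qed.

Lemma derivable_has_derivative_within V (F : R -> V) t :
  derivable F t 1 -> has_derivative_within V F t ('D_1 F t).
Proof.
move=> Fd.
have st0 : (s - t) @[s --> within `[a, b] t^'] --> (0 : R)^'.
  by apply: cvg_trans (dnbhs_unshift t); apply: cvg_app; exact: cvg_within.
rewrite /has_derivative_within.
rewrite (_ : (fun s => _) =
  (fun h => h^-1 *: ((F \o shift t) (h *: 1) - F t)) \o (fun s => s - t)).
  exact: cvg_comp st0 Fd.
by apply/funext => s /=; rewrite [_%:A]mulr1 subrK.
Qed.

(** Near an interior point the restriction to [[a, b]] is void. This gives access to the
    monotonicity criterion for derivable functions. *)
Lemma has_derivative_within_derivable V (F : R -> V) t v : t \in `]a, b[ ->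
  has_derivative_within V F t v -> derivable F t 1 /\ 'D_1 F t = v.
Proof.
move=> tab Fv.
have Fv' : h^-1 *: ((F \o shift t) (h *: 1) - F t) @[h --> 0^'] --> v.
  have tab' : within `[a, b] t^' `<=` t^'.
    move=> P P0.
    have {P0}Pt : \forall s \near t, s != t -> s \in `[a, b] -> P s := P0.
    have tab' : \forall s \near t, s \in `]a, b[ by exact: near_in_itvoo.
    suff : \forall s \near t, s != t -> P s by [].
    by apply: filterS2 Pt tab' => s Ps sab st; apply/Ps/subset_itv_oo_cc.
  rewrite (_ : (fun h => _) = (fun s => (s - t)^-1 *: (F s - F t)) \o (+%R^~ t)).
    exact: cvg_comp (dnbhs_shift t) (cvg_trans (cvg_app _ tab') Fv).
  by apply/funext => h /=; rewrite [_%:A]mulr1 addrK.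
by split; [apply/cvg_ex; exists v|apply: cvg_lim Fv'; exact: norm_hausdorff].
Qed.

(** [F] is nondecreasing but does not increase overall, so it is constant. *)
Lemma nondecreasing_const_derivative (F f : R -> R) : a < b ->
  (forall t, t \in `[a, b] -> has_derivative_within _ F t (f t)) ->
  (forall t, t \in `[a, b] -> 0 <= f t) -> F b <= F a ->
  forall t, t \in `[a, b] -> f t = 0.
Proof.
move=> ab Ff f0 Fba.
have homoF : {in `[a, b] &, {homo F : x y / x <= y}}.
  apply: ger0_derive1_le_cc; last exact: has_derivative_within_continuous Ff.
    move=> t tab; have /Ff := subset_itv_oo_cc tab.
    by move=> /(has_derivative_within_derivable _ _ _ _ tab)[].
  move=> t tab; have tab' := subset_itv_oo_cc tab.
  have [_] := has_derivative_within_derivable _ _ _ _ tab (Ff _ tab').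
  by rewrite derive1E => ->; exact: f0.
have aab : a \in `[a, b] by rewrite in_itv/= lexx ltW.
have bab : b \in `[a, b] by rewrite in_itv/= lexx ltW.
have Fa t : t \in `[a, b] -> F t = F a.
  move=> tab; move: (tab); rewrite in_itv/= => /andP[ta tb].
  apply/eqP; rewrite eq_le (le_trans _ Fba) ?homoF//.
move=> t tab; apply: (has_derivative_within_unique _ F t _ _ ab tab (Ff _ tab)).
apply: cvg_near_cst.
suff : \forall s \near t, s != t -> s \in `[a, b] -> (s - t)^-1 *: (F s - F t) = 0 by [].
by apply: (@filterE _ (nbhs t)) => s _ sab; rewrite !Fa// subrr scaler0.
Qed.

End DerivativeWithin.

(** * Linear forms, coordinatewise limits and antiderivatives *)

Section RowVectors.
Context {R : realType} {n : nat}.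

Definition lin_form (f : 'cV[R]_n) (x : 'rV[R]_n) : R := (x *m f) 0 0.

Fact lin_form_linear f : linear (lin_form f : 'rV[R]_n -> R^o).
Proof. by move=> c x y; rewrite /lin_form mulmxDl -scalemxAl !mxE. Qed.

HB.instance Definition _ f :=
  GRing.isLinear.Build R 'rV[R]_n R^o *:%R (lin_form f) (lin_form_linear f).

Lemma cvg_lin_form T (F : set_system T) {FF : Filter F} f (h : T -> 'rV[R]_n) v :
  h @ F --> v -> lin_form f (h s) @[s --> F] --> lin_form f v.
Proof.
move=> hv; rewrite /lin_form mxE; under eq_fun do rewrite mxE.
apply: cvg_big => [|i _]; first exact: add_continuous.
apply: cvgMr_tmp.
by apply: (cvg_comp h (fun w : 'rV[R]_n => w 0 i) hv); exact: coord_continuous.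
Qed.

Lemma lin_form_continuous f : continuous (lin_form f).
Proof. by move=> x; exact: (@cvg_lin_form _ (nbhs x) _ f id x cvg_id). Qed.

Lemma lin_form_tr_gt0 f : f != 0 -> 0 < lin_form f f^T.
Proof.
move=> f0; rewrite lt_neqAle; apply/andP; split; last first.
  by rewrite /lin_form mxE; apply: sumr_ge0 => i _; rewrite mxE -expr2 sqr_ge0.
apply: contra f0; rewrite eq_sym /lin_form mxE psumr_eq0; last first.
  by move=> i _; rewrite mxE -expr2 sqr_ge0.
move=> /allP f0; apply/eqP/colP => i; have := f0 i (mem_index_enum i).
by rewrite /= !mxE mulf_eq0 orbb => /eqP.
Qed.

Lemma cvg_rV T (F : set_system T) {FF : Filter F} (h : T -> 'rV[R]_n) (v : 'rV[R]_n) :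
  (forall j, h s 0 j @[s --> F] --> v 0 j) -> h @ F --> v.
Proof.
move=> hv; rewrite [v]row_sum_delta.
rewrite (_ : h = fun s => \sum_j h s 0 j *: delta_mx 0 j); last first.
  by apply/funext => s; exact: row_sum_delta.
apply: cvg_big => [|i _]; first exact: add_continuous.
exact: cvgZr_tmp.
Qed.

End RowVectors.

Lemma continuous_has_antiderivative (R : realType) (a b : R) (h : R -> R) :
  a < b -> {within `[a, b], continuous h} ->
  exists F : R -> R, forall t, t \in `[a, b] -> has_derivative_within a b R F t (h t).
Proof.
move=> ab hc.
(* Precomposing with the retraction onto [[a, b]] extends [h] continuously to the line. *)
pose clamp (t : R) := Num.max a (Num.min b t).
have clamp_in t : clamp t \in `[a, b].
  by rewrite in_itv/= le_max lexx/= ge_max (ltW ab) ge_min lexx.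
have clampE t : t \in `[a, b] -> clamp t = t.
  by rewrite in_itv/= /clamp => /andP[ta tb]; rewrite min_r// max_r.
have clampc : continuous clamp.
  move=> t; apply: (@continuous_max _ _ (cst a) (fun t => Num.min b t)).
    exact: cst_continuous.
  by apply: (@continuous_min _ _ (cst b) id) => //; exact: cst_continuous.
have hc' : continuous (h \o clamp).
  move=> t; have /subspace_continuousP/(_ _ (clamp_in t)) := hc.
  apply: (cvg_comp clamp h) => P P0.
  have {P0}Pt : \forall s \near clamp t, s \in `[a, b] -> P s := P0.
  have Pct : \forall s \near t, clamp s \in `[a, b] -> P (clamp s) := clampc t _ Pt.
  have : \forall s \near t, P (clamp s) by apply: filterS Pct => s; apply.
  exact.
(* Starting at [a - 1], and integrating within [[a - 1, b + 1]], makes [a] and [b] interior points,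
   where the fundamental theorem applies. *)
exists (fun x => \int[lebesgue_measure]_(t in `[a - 1, x]) (h \o clamp) t).
move=> t tab; have [] := @continuous_FTC1_closed R (h \o clamp) (a - 1) t (b + 1).
- by move: tab; rewrite in_itv/= => /andP[_ tb]; rewrite ltr_pwDr.
- apply: continuous_compact_integrable; first exact: segment_compact.
  exact: continuous_subspaceT.
- by move: tab; rewrite in_itv/= => /andP[ta _]; rewrite ltrBlDr ltr_pwDr.
- exact: hc'.
move=> /(derivable_has_derivative_within a b) + Ft.
by rewrite -derive1E Ft /= clampE.
Qed.

Lemma continuous_has_antiderivative_rV (R : realType) n (a b : R) (h : R -> 'rV[R]_n) :
  a < b -> {within `[a, b], continuous h} ->
  exists F : R -> 'rV[R]_n,
    forall t, t \in `[a, b] -> has_derivative_within a b _ F t (h t).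
Proof.
move=> ab hc.
have hj j : exists F : R -> R,
    forall t, t \in `[a, b] -> has_derivative_within a b R F t (h t 0 j).
  apply: continuous_has_antiderivative => //.
  apply/subspace_continuousP => t tab.
  move/subspace_continuousP/(_ t tab) : hc => hc.
  by apply: (cvg_comp h (fun v : 'rV[R]_n => v 0 j) hc); exact: coord_continuous.
have [F FP] := choice hj.
exists (fun t => \row_j F j t) => t tab.
apply: cvg_rV => j; under eq_fun do rewrite !mxE.
exact: FP.
Qed.

(** * Velocities computed through lifts to the covering space *)

Section Lifts.
Context {R : realType} {n : nat} (G : zmodClosed 'rV[R]_n) (a b : R).
Hypotheses (hG : discrete_subgroup G) (ab : a < b).
Implicit Types (t : R) (alpha beta : R -> 'rV[R]_n) (sigma : R -> Quotient.quot G).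

Lemma quot_piP (x y : 'rV[R]_n) :
  \pi_(Quotient.quot G)%qT x = \pi_(Quotient.quot G)%qT y <-> x - y \in G.
Proof. by rewrite Quotient.idealrBE; split=> /eqP. Qed.

(* Two continuous lifts differ by a continuous map into the discrete set [G],
   which is locally constant. *)
Lemma has_derivative_within_lift t alpha beta v : t \in `[a, b] ->
  (\forall s \near within `[a, b] (nbhs t), alpha s - beta s \in G) ->
  alpha s @[s --> within `[a, b] (nbhs t)] --> alpha t ->
  has_derivative_within a b _ beta t v -> has_derivative_within a b _ alpha t v.
Proof.
move=> tab abG alphac betav.
have [V Vt VG] : exists2 V, nbhs (alpha t - beta t) V &
    V `&` [set` G] = [set alpha t - beta t].
  have tG : alpha t - beta t \in G by exact: (nbhs_singleton abG tab).
  have : isolated [set` G] (alpha t - beta t) by rewrite hG.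
  by case.
have : (alpha s - beta s) @[s --> within `[a, b] (nbhs t)] --> alpha t - beta t.
  by apply: cvgB => //; exact: (has_derivative_within_cvg _ _ _ _ _ _ betav).
move=> /(_ _ Vt) Vab0.
have Vab : \forall s \near t, s \in `[a, b] -> V (alpha s - beta s) := Vab0.
have {}abG : \forall s \near t, s \in `[a, b] -> alpha s - beta s \in G := abG.
apply: cvg_trans betav; apply: near_eq_cvg.
suff : \forall s \near t, s != t -> s \in `[a, b] ->
    (s - t)^-1 *: (beta s - beta t) = (s - t)^-1 *: (alpha s - alpha t) by [].
apply: filterS2 Vab abG => s /[swap] sG Vs _ sab; congr (_ *: _).
have /[!VG] E : (V `&` [set` G]) (alpha s - beta s) by split; [exact: Vs|exact: sG].
by rewrite -[alpha s](subrK (beta s)) E addrAC [X in _ = X + _]addrAC subrr sub0r addrC.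
Qed.

(** The given lift and the local lift witnessing the velocity differ by elements of [G]. *)
Lemma has_velocity_lift sigma t alpha v : t \in `[a, b] ->
  (forall s, s \in `[a, b] -> sigma s = \pi_(Quotient.quot G)%qT (alpha s)) ->
  alpha s @[s --> within `[a, b] (nbhs t)] --> alpha t ->
  has_velocity a b sigma t v -> has_derivative_within a b _ alpha t v.
Proof.
move=> tab sigmaE alphac [beta betaE betav].
apply: has_derivative_within_lift alphac betav => //.
have {}betaE : \forall s \near t, s \in `[a, b] ->
  sigma s = \pi_(Quotient.quot G)%qT (beta s) := betaE.
suff : \forall s \near t, s \in `[a, b] -> alpha s - beta s \in G by [].
by apply: filterS betaE => s E sab; apply/quot_piP; rewrite -sigmaE// E.
Qed.

(** The value chosen by [xget] is a derivative of the same lift, so uniqueness of derivatives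
    determines it. *)
Lemma velocity_lift sigma t alpha v : t \in `[a, b] ->
  (forall s, s \in `[a, b] -> sigma s = \pi_(Quotient.quot G)%qT (alpha s)) ->
  has_derivative_within a b _ alpha t v ->
  has_velocity a b sigma t v /\ velocity a b sigma t = v.
Proof.
move=> tab sigmaE alphav.
have sv : has_velocity a b sigma t v.
  exists alpha => //.
  suff : \forall s \near t, s \in `[a, b] ->
    sigma s = \pi_(Quotient.quot G)%qT (alpha s) by [].
  by apply: (@filterE _ (nbhs t)).
split=> //.
have vel : has_velocity a b sigma t (velocity a b sigma t).
  exact: (@xgetI _ 0 [set v | has_velocity a b sigma t v] v sv).
apply: (has_derivative_within_unique _ _ _ alpha t _ _ ab tab _ alphav).
apply: has_velocity_lift vel => //.
exact: has_derivative_within_cvg alphav.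
Qed.

End Lifts.

(** * Unit vectors and the lines they span *)

Section SphericalLoop.
Context {R : realType} {n : nat}.
Implicit Types (v w : 'rV[R]_n).

Lemma euclidean_normZ (c : R) v :
  euclidean_norm (c *: v) = `|c| * euclidean_norm v.
Proof.
rewrite /euclidean_norm -sqrtr_sqr -sqrtrM ?sqr_ge0// mulr_sumr.
by under eq_bigr do rewrite mxE exprMn.
Qed.

Lemma euclidean_norm_gt0 v : v != 0 -> 0 < euclidean_norm v.
Proof.
move=> v0; rewrite sqrtr_gt0 lt_neqAle sumr_ge0 ?andbT; last first.
  by move=> i _; exact: sqr_ge0.
apply: contra v0; rewrite eq_sym psumr_eq0 => [/allP vi|i _]; last exact: sqr_ge0.
apply/eqP/rowP => i; have := vi i (mem_index_enum i).
by rewrite /= mxE sqrf_eq0 => /eqP.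
Qed.

Lemma unit_sphere_neq0 v : unit_sphere v -> v != 0.
Proof.
move=> v1; apply/eqP => v0; move: v1; rewrite /unit_sphere/= v0 -(scale0r 0).
by rewrite euclidean_normZ normr0 mul0r => /eqP; rewrite eq_sym oner_eq0.
Qed.

Lemma unit_sphere_collinear (c : R) v w :
  unit_sphere v -> unit_sphere w -> v = c *: w -> v = w \/ v = - w.
Proof.
rewrite /unit_sphere/= => v1 w1 vw; move: v1.
rewrite vw euclidean_normZ w1 mulr1 => /eqP.
by rewrite eqr_norml => /andP[/orP[]/eqP ->]; rewrite ?scale1r ?scaleN1r; auto.
Qed.

Lemma vlineZ (c : R) v : c != 0 -> (<[c *: v]> = <[v]>)%VS.
Proof.
move=> c0; apply/eqP; rewrite eqEsubv -!memvE memvZ ?memv_line//=.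
by rewrite -[X in X \in _](scalerK c0) memvZ// memv_line.
Qed.

End SphericalLoop.

(** * The cone of displacements of positive periodic densities *)

Section Densities.
Context {R : realType} {n : nat} (a b : R) (tau : R -> 'rV[R]_n).
Hypotheses (n0 : (0 < n)%N) (ab : a < b).
Hypotheses (tauc : {within `[a, b], continuous tau}) (tau_ab : tau a = tau b).

(* The displacements [\int_a^b rho tau] of the periodic positive densities [rho]. *)
Definition displacement : set 'rV[R]_n :=
  [set x | exists (rho : R -> R) (F : R -> 'rV[R]_n),
    [/\ {within `[a, b], continuous rho},
        forall t, t \in `[a, b] -> 0 < rho t,
        rho a = rho b,
        forall t, t \in `[a, b] -> has_derivative_within a b _ F t (rho t *: tau t)
      & x = F b - F a]].

Lemma within_continuousZ (rho : R -> R) :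
  {within `[a, b], continuous rho} ->
  {within `[a, b], continuous (fun t => rho t *: tau t)}.
Proof.
move=> /subspace_continuousP rhoc; apply/subspace_continuousP => t tab.
by apply: cvgZ; [exact: rhoc|move/subspace_continuousP : tauc; exact].
Qed.

Lemma displacement_convex_cone : convex_cone displacement.
Proof.
apply/convex_coneP; split=> [c _ c0 [rho [F [rhoc rho0 rhoab FE ->]]]|
    _ _ [rho [F [rhoc rho0 rhoab FE ->]]] [rho' [F' [rhoc' rho0' rhoab' FE' ->]]]].
- exists (c \*: (rho : R -> R^o)), (c \*: F); split=> [|t tab||t tab|] /=.
  + move/subspace_continuousP in rhoc; apply/subspace_continuousP => t tab.
    by apply: (@cvgZl_tmp _ R^o); exact: rhoc.
  + by rewrite mulr_gt0// rho0.
  + by rewrite rhoab.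
  + by rewrite -[X in X *: _]/(c * rho t) -scalerA; exact/has_derivative_withinZ/FE.
  + by rewrite scalerBr.
- exists (rho + rho'), (F + F'); split=> [|t tab||t tab|].
  + move/subspace_continuousP in rhoc; move/subspace_continuousP in rhoc'.
    apply/subspace_continuousP => t tab.
    by apply: (@cvgD _ R^o); [exact: rhoc|exact: rhoc'].
  + by rewrite addr_gt0// (rho0, rho0').
  + by rewrite !fctE rhoab rhoab'.
  + by rewrite fctE scalerDl; apply: has_derivative_withinD; [exact: FE|exact: FE'].
  + by rewrite !fctE opprD addrACA.
Qed.

Lemma displacement_of_density (rho : R -> R) :
  {within `[a, b], continuous rho} -> (forall t, t \in `[a, b] -> 0 < rho t) ->
  rho a = rho b -> displacement !=set0.
Proof.
move=> rhoc rho0 rhoab.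
have [F FE] := continuous_has_antiderivative_rV _ _ _ _ _ ab (within_continuousZ _ rhoc).
by exists (F b - F a), rho, F.
Qed.

(* Testing [f] against the density [1 + k * max(- f \o tau, 0)], which only
   depends on [tau] and is thus periodic, for large [k]. *)
Lemma displacement_support (f : 'cV[R]_n) :
  (forall x, displacement x -> 0 <= lin_form f x) ->
  forall t, t \in `[a, b] -> 0 <= lin_form f (tau t).
Proof.
move=> fD.
pose neg t := Num.max (- lin_form f (tau t)) 0.
have neg0 t : 0 <= neg t by rewrite /neg le_max lexx orbT.
have negc : {within `[a, b], continuous neg}.
  have Nc : continuous (fun v => Num.max (- lin_form f v) 0).
    move=> v; apply: (@continuous_max _ _ (fun v => - lin_form f v) (cst 0)).
      exact/continuousN/lin_form_continuous.
    exact: cst_continuous.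
  apply/subspace_continuousP => t tab.
  have /subspace_continuousP/(_ t tab) tauct := tauc.
  exact: (cvg_comp tau (fun v => Num.max (- lin_form f v) 0) tauct (Nc (tau t))).
have [F FE] := continuous_has_antiderivative_rV _ _ _ _ _ ab (within_continuousZ _ negc).
have [F1 F1E] := continuous_has_antiderivative_rV _ _ _ _ _ ab tauc.
have F_ge0 : 0 <= lin_form f (F b - F a).
  (* The density [k * neg + 1] has displacement [k] times that of [neg] plus that of 1; large [k]
     isolates the first term. *)
  have kF k : 0 < k -> k * - lin_form f (F b - F a) <= lin_form f (F1 b - F1 a).
    move=> k0; rewrite mulrN lerNl -subr_ge0 opprK.
    rewrite -[k * _]/(k *: (lin_form f (F b - F a) : R^o)) -linearZ -linearD.
    apply: fD; exists (fun t => k * neg t + 1), (k \*: F + F1); split.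
    - move/subspace_continuousP in negc; apply/subspace_continuousP => t tab.
      apply: (@cvgD _ R^o); last exact: cvg_cst.
      by apply: (@cvgZl_tmp _ R^o); exact: negc.
    - by move=> t _; rewrite ltr_wpDl// mulr_ge0// ltW.
    - by rewrite /neg tau_ab.
    - move=> t tab; rewrite scalerDl scale1r -scalerA.
      by apply: has_derivative_withinD; [exact/has_derivative_withinZ/FE|exact: F1E].
    - by rewrite !fctE scalerBr opprD addrACA.
  by have [_] := le_of_scaled _ _ _ kF; rewrite oppr_le0.
(* This product is the square of [neg t], and its antiderivative [- f \o F] does not increase
   overall. *)
have neg_sq t : t \in `[a, b] -> neg t * - lin_form f (tau t) = 0.
  apply: (nondecreasing_const_derivative a b (- (lin_form f \o F))
    (fun t => neg t * - lin_form f (tau t)) ab).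
  - move=> s sab; rewrite mulrN -mulN1r mulrA mulN1r mulNr -mulN1r.
    have := has_derivative_within_comp_linear _ _ _ _ _ _ _ (lin_form f)
      (lin_form_continuous f) (FE s sab).
    move=> /(has_derivative_withinZ _ _ _ _ _ _ (-1)).
    rewrite linearZ (_ : -1 \*: _ = - (lin_form f \o F))//.
    by apply/funext => u /=; rewrite scaleN1r.
  - move=> s _; rewrite /neg; case: (leP (- lin_form f (tau s)) 0) => h.
      by rewrite mul0r.
    by rewrite -expr2 sqr_ge0.
  - by rewrite !fctE lerN2 -subr_ge0 -linearB.
move=> t tab; have := neg_sq t tab; rewrite /neg.
case: (leP (- lin_form f (tau t)) 0) => [|h /eqP]; first by rewrite oppr_le0.
by rewrite mulf_eq0 orbb => /eqP h0; move: h; rewrite h0 ltxx.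
Qed.

Lemma interior_Cc_displacement : (Cc (tau @` `[a, b]))° `<=` displacement.
Proof.
move=> g gC; apply: contrapT => Dg.
have D0 : displacement !=set0.
  by apply: (displacement_of_density (cst 1)) => //; exact: cst_continuous.
have [f [f0 fD fg]] :=
  convex_cone_separation _ _ _ _ n0 D0 displacement_convex_cone Dg.
have ftau := displacement_support f fD.
have fC : Cc (tau @` `[a, b]) `<=` [set x | 0 <= lin_form f x].
  move=> x; apply; split; last by move=> _ [t tab <-]; exact: ftau.
  apply/convex_coneP; split=> [c y c0|y z] /=.
    by rewrite linearZ => ?; rewrite mulr_ge0// ltW.
  by rewrite linearD; exact: addr_ge0.
(* Moving from the interior point [g] against [f^T] stays in the cone for a while, yet makes [f]
   negative. *)
have : (fun e : R => g - e *: f^T) @ (0 : R) --> g.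
  rewrite -[X in _ --> X]subr0 -[in X in _ --> X](scale0r f^T).
  have fe : (fun e : R => e *: f^T) @ (0 : R) --> 0 *: f^T.
    exact: (@cvgZr_tmp _ _ _ (nbhs (0 : R)) _ id 0 f^T cvg_id).
  exact: (@cvgB _ _ _ (nbhs (0 : R)) _ (cst g) _ g _ (cvg_cst g) fe).
move=> /(_ _ gC) gCe.
have [d /= d0 gCd] : nbhs_ball (0 : R) [set e | Cc (tau @` `[a, b]) (g - e *: f^T)].
  exact/nbhs_ballP/gCe.
have e0 : 0 < d / 2 by rewrite divr_gt0.
have /gCd/fC/= : ball (0 : R) d (d / 2).
  by rewrite /ball/= sub0r normrN gtr0_norm//; lra.
rewrite linearB linearZ /= => h.
have : 0 < d / 2 * lin_form f f^T by rewrite mulr_gt0// lin_form_tr_gt0.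
by move: h fg; rewrite -/(lin_form f g) -[_ *: _]/(_ * _); lra.
Qed.

End Densities.

(** * Fullness, and the two implications *)

Lemma full_lin_form (R : realType) (n : nat) (a b : R) (tau : R -> 'rV[R]_n)
    (f : 'cV[R]_n) :
  full a b tau -> (forall t, t \in `[a, b] -> lin_form f (tau t) = 0) -> f = 0.
Proof.
move=> tau_full f0; apply/eqP; apply: contraT => /lin_form_tr_gt0 fT.
(* The kernel of [f] is a subspace containing [tau], so by fullness it contains [f^T], where [f] is
   positive. *)
have fU : linear_span (tau @` `[a, b]) f^T by rewrite tau_full.
have : f^T \in lker (linfun (lin_form f : {linear 'rV[R]_n -> R^o})).
  by apply: fU => _ [t tab <-]; rewrite memv_ker lfunE /= f0.
by rewrite memv_ker lfunE /= => /eqP f0'; move: fT; rewrite f0' ltxx.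
Qed.

Lemma displacement_in_interior_Cc (R : realType) (n : nat) (a b : R)
    (tau alpha : R -> 'rV[R]_n) (rho : R -> R) :
  (0 < n)%N -> a < b -> full a b tau ->
  (forall t, t \in `[a, b] -> 0 < rho t) ->
  (forall t, t \in `[a, b] -> has_derivative_within a b _ alpha t (rho t *: tau t)) ->
  (Cc (tau @` `[a, b]))° (alpha b - alpha a).
Proof.
move=> n0 ab tau_full rho0 alphaE; apply: contrapT => gC.
have tauC t : t \in `[a, b] -> Cc (tau @` `[a, b]) (tau t).
  by move=> tab; apply: sub_gen_smallest; exists t.
have C0 : Cc (tau @` `[a, b]) !=set0.
  by exists (tau a); apply: tauC; rewrite in_itv/= lexx ltW.
have [f [f0 fC fg]] :=
  convex_cone_interior_support _ _ _ _ n0 C0 (Cc_convex_cone _) gC.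
move/eqP : f0; apply; apply: (full_lin_form _ _ _ _ _ _ tau_full) => t tab.
(* This is the derivative of [f \o alpha], nonnegative with nonpositive total increment. *)
have : rho t * lin_form f (tau t) = 0.
  apply: (nondecreasing_const_derivative a b (lin_form f \o alpha)
    (fun t => rho t * lin_form f (tau t)) ab) => // [s sab|s sab|].
  - have := has_derivative_within_comp_linear _ _ _ _ _ _ _ (lin_form f)
      (lin_form_continuous f) (alphaE s sab).
    by rewrite linearZ.
  - rewrite mulr_ge0 ?(ltW (rho0 s sab))//; apply: fC; exact: tauC.
  - by rewrite -subr_le0 /= -linearB.
by move=> /eqP; rewrite mulf_eq0 (gt_eqF (rho0 t tab)) => /eqP.
Qed.

Theorem theorem3p7 (R : realType) (n : nat) (G : zmodClosed 'rV[R]_n)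
    (hG : discrete_subgroup G) (g : 'rV[R]_n) (hg : g \in G)
    (a b : R) (hab : a < b) (tau : R -> 'rV[R]_n)
    (tau_loop : spherical_loop a b tau) (tau_full : full a b tau) :
  (exists sigma : R -> Quotient.quot G,
     [/\ quotient_loop a b sigma,
         skew_loop a b sigma,
         homotopic_to g a b sigma
       & forall t, t \in `[a, b] -> tantrix a b sigma t = tau t])
  <->
  [/\ embedded a b tau,
      (tau @` `[a, b]) `&` (-%R @` (tau @` `[a, b])) = set0
    & (Cc (tau @` `[a, b]))° g].
Proof.
case: tau_loop => tauc tau1 tau_ab.
have ab_in t : t \in `[a, b[ -> t \in `[a, b] by exact: subset_itv_co_cc.
have aab : a \in `[a, b] by rewrite in_itv/= lexx ltW.
have bab : b \in `[a, b] by rewrite in_itv/= lexx ltW.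
have aab' : a \in `[a, b[ by rewrite in_itv/= lexx.
have tau0 t : t \in `[a, b] -> tau t != 0.
  by move=> /tau1; exact: unit_sphere_neq0.
(* The parameter [b] is traded for [a], as skewness and embeddedness concern [[a, b[] only. *)
have circle t : t \in `[a, b] -> exists2 s, s \in `[a, b[ & tau s = tau t.
  rewrite in_itv/= [t <= b]le_eqVlt => /andP[ta /predU1P[->|tb]].
    by exists a.
  by exists t => //; rewrite in_itv/= ta.
have n0 : (0 < n)%N.
  rewrite lt0n; apply: contra (tau0 a aab) => /eqP nE.
  by apply/eqP/rowP => -[j jn]; exfalso; move: jn; rewrite nE.
split=> [[sigma [[[sigmav sigmac sigma0] _ _] skew [alpha [alphac sigmaE alphag]] tanE]]|
    [inj antipodal gC]].
- set v := velocity a b sigma in sigmav sigmac sigma0.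
  have N0 t : t \in `[a, b] -> 0 < euclidean_norm (v t).
    by move=> /sigma0; exact: euclidean_norm_gt0.
  have vE t : t \in `[a, b] -> v t = euclidean_norm (v t) *: tau t.
    move=> tab; rewrite -tanE// /tantrix -/v scalerA divff ?scale1r//.
    by rewrite gt_eqF// N0.
  have line_v t : t \in `[a, b] -> (<[v t]> = <[tau t]>)%VS.
    by move=> tab; rewrite vE// vlineZ// gt_eqF// N0.
  (* Skewness restated for [tau]; it yields both embeddedness and avoidance of the antipodal
     image. *)
  have line_inj t1 t2 : t1 \in `[a, b[ -> t2 \in `[a, b[ ->
      (<[tau t1]> = <[tau t2]>)%VS -> t1 = t2.
    move=> t1ab t2ab tauE; apply/eqP; apply: contraT => /(skew _ _ t1ab t2ab).
    by rewrite -/v !line_v ?ab_in// tauE eqxx.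
  split.
  + by move=> t1 t2 t1ab t2ab tauE; apply: line_inj => //; rewrite tauE.
  + apply/seteqP; split=> // _ [[t1 t1ab <-] [_ [t2 t2ab <-]]] tauE.
    have [s1 s1ab s1E] := circle t1 t1ab.
    have [s2 s2ab s2E] := circle t2 t2ab.
    (* Antipodal vectors span the same line, so the parameters agree and [tau t1] equals its own
       opposite. *)
    have s12 : s1 = s2.
      apply: line_inj => //; rewrite s1E s2E -tauE -scaleN1r vlineZ//.
    have E : tau t1 = - tau t1 by rewrite -{2}s1E s12 s2E tauE.
    have /eqP : 2 *: tau t1 = 0 by rewrite scaler_nat mulr2n {2}E subrr.
    by rewrite scaler_eq0 pnatr_eq0 (negbTE (tau0 t1 t1ab)).
  (* The density is the speed of [sigma]. *)
  + rewrite -alphag.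
    apply: (displacement_in_interior_Cc _ _ _ _ _ _ _ n0 hab tau_full N0) => t tab.
    rewrite -vE//; apply: (has_velocity_lift _ _ _ hG sigma) => //.
      by move/subspace_continuousP : alphac; exact.
    exact: sigmav.
- have [rho [F [rhoc rho0 rhoab FE gE]]] :=
    interior_Cc_displacement _ _ _ n0 hab tauc tau_ab _ gC.
  pose sigma t := \pi_(Quotient.quot G)%qT (F t).
  have vP t : t \in `[a, b] -> has_velocity a b sigma t (rho t *: tau t) /\
      velocity a b sigma t = rho t *: tau t.
    by move=> tab; apply: (velocity_lift _ _ _ hG hab _ _ F) => //; exact: FE.
  have vE t : t \in `[a, b] -> velocity a b sigma t = rho t *: tau t.
    by move=> /vP[].
  exists sigma; split.
  + split; [split|..].
    * by move=> t tab; rewrite vE//; have [] := vP t tab.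
    * apply: (@subspace_eq_continuous _ _ _ (fun t => rho t *: tau t)).
        by move=> t /set_mem tab; rewrite /from_subspace /= vE.
      exact: within_continuousZ.
    * by move=> t tab; rewrite vE// scaler_eq0 gt_eqF ?rho0//= tau0.
    (* The projected curve closes up because [F b - F a = g] lies in [G]. *)
    * by apply/esym/quot_piP; rewrite -gE.
    * by rewrite !vE// rhoab tau_ab.
  (* Unit vectors on one line are equal or opposite: embeddedness settles the first case, the
     antipodal condition the second. *)
  + move=> t1 t2 t1ab t2ab; apply: contra_neqN => /eqP.
    rewrite !vE ?ab_in// !vlineZ ?gt_eqF ?rho0 ?ab_in// => tauE.
    have /vlineP[c cE] : tau t1 \in <[tau t2]>%VS by rewrite -tauE memv_line.
    have [/inj -> //|tauN] := unit_sphere_collinear _ _ _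
      (tau1 _ (ab_in _ t1ab)) (tau1 _ (ab_in _ t2ab)) cE.
    suff : (set0 : set 'rV[R]_n) (tau t1) by [].
    rewrite -antipodal; split; first by exists t1 => //; exact: ab_in.
    by exists (tau t2) => //; exists t2 => //; exact: ab_in.
  + exists F; split=> //; exact: has_derivative_within_continuous FE.
  + move=> t tab; rewrite /tantrix vE// euclidean_normZ (tau1 t tab) mulr1.
    by rewrite gtr0_norm ?rho0// scalerA mulVf ?scale1r// gt_eqF// rho0.
Qed.
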